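(* Up to isomorphism of hyperfields, there are exactly two hyperfields of order $2$, namely the finite field $\mathbb{F}_2$ (regarded as a hyperfield) and the Krasner hyperfield $\mathbb{K}$ (and these two are different).
   Context: A hyperoperation on a set $S$ is a map $\boxplus: S\times S\to 2^S\setminus\{\varnothing\}$; for non-empty $A,B\subseteq S$ put $A\boxplus B=\bigcup_{a\in A,b\in B}(a\boxplus b)$ (singletons are identified with their elements). It is commutative if $a\boxplus b=b\boxplus a$, and associative if $a\boxplus(b\boxplus c)=(a\boxplus b)\boxplus c$ for all $a,b,c$. All hyperoperations are assumed commutative. A hypergroup $(G,\boxplus,0)$ is a set with an associative hyperoperation such that: (1) $0\boxplus x=\{x\}$ for all $x$; (2) for every $x$ there is a unique element $-x$ with $0\in x\boxplus(-x)$; (3) $x\in y\boxplus z$ if and only if $z\in x\boxplus(-y)$. A hyperring is a tuple $(R,\odot,\boxplus,1,0)$ such that $(R,\odot,1)$ is a commutative monoid, $(R,\boxplus,0)$ is a commutative hypergroup, $0\odot x=x\odot 0=0$ for all $x$, and $a\odot(x\boxplus y)=(a\odot x)\boxplus(a\odot y)$ and $(x\boxplus y)\odot a=(x\odot a)\boxplus(y\odot a)$ for all $a,x,y$ (where $a\odot A=\{a\odot s: s\in A\}$, and similarly for $A\odot a$). A hyperfield is a hyperring with $0\ne1$ in which every nonzero element has a multiplicative inverse. The order of a finite hyperfield is the cardinality of its underlying set. A homomorphism of hyperfields $f:\mathbb{F}\to\mathbb{L}$ is a map with $f(0)=0$, $f(1)=1$, $f(xy)=f(x)f(y)$ and $f(x\boxplus_{\mathbb{F}}y)\subseteq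 f(x)\boxplus_{\mathbb{L}}f(y)$ for all $x,y$. An isomorphism is a homomorphism having a two-sided inverse that is also a homomorphism. A field $\mathbb{F}$ is regarded as a hyperfield via $x\odot y=x\cdot y$, $x\boxplus y=\{x+y\}$. The Krasner hyperfield $\mathbb{K}$ is $\{0,1\}$ with the usual multiplication and $0\boxplus0=\{0\}$, $0\boxplus1=1\boxplus0=\{1\}$, $1\boxplus1=\{0,1\}$. *)

(* Defs.v *)
From mathcomp Require Import all_boot all_algebra.
From mathcomp Require Import boolp classical_sets functions cardinality.

Set Implicit Arguments.
Unset Strict Implicit.
Unset Printing Implicit Defensive.

Import GRing.Theory.

Local Open Scope classical_set_scope.
Local Open Scope card_scope.

Section Hyperoperations.
Variables (T : Type) (add : T -> T -> set T).

Definition is_hyperoperation := forall a b, add a b !=set0.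

Definition setadd (A B : set T) : set T :=
  \bigcup_(a in A) \bigcup_(b in B) add a b.

Record hypergroup (zero : T) : Prop := Hypergroup {
  hgroup_nonempty : is_hyperoperation;
  hgroup_comm : forall a b, add a b = add b a;
  hgroup_assoc : forall a b c,
    setadd [set a] (add b c) = setadd (add a b) [set c];
  hgroup_add0 : forall x, add zero x = [set x];
  hgroup_opp : forall x, exists! y, add x y zero;
  (* [ny] is the opposite of [y], unique by [hgroup_opp] *)
  hgroup_reversible : forall x y z ny, add y ny zero ->
    (add y z x <-> add x ny z)
}.

End Hyperoperations.

Record hyperring := Hyperring {
  hsort :> Type;
  hmul : hsort -> hsort -> hsort;
  hadd : hsort -> hsort -> set hsort;
  hone : hsort;
  hzero : hsort;
  hmulA : associative hmul;
  hmulC : commutative hmul;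
  hmul1 : left_id hone hmul;
  hadd_hypergroup : hypergroup hadd hzero;
  hmul0l : left_zero hzero hmul;
  hmul0r : right_zero hzero hmul;
  hmulDr : forall a x y, hmul a @` hadd x y = hadd (hmul a x) (hmul a y);
  hmulDl : forall a x y, hmul^~ a @` hadd x y = hadd (hmul x a) (hmul y a)
}.

Arguments hone {h}.
Arguments hzero {h}.

Record hyperfield := Hyperfield {
  hring :> hyperring;
  hzero_neq_one : hzero <> hone :> hring;
  hmulV : forall x : hring, x <> hzero -> exists y, hmul x y = hone
}.

Definition has_order (F : hyperfield) (n : nat) := [set: F] #= `I_n.

Record hyperfield_hom (F L : hyperfield) (f : F -> L) : Prop := HyperfieldHom {
  hhom0 : f hzero = hzero;
  hhom1 : f hone = hone;
  hhomM : forall x y, f (hmul x y) = hmul (f x) (f y);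
  hhomD : forall x y, f @` hadd x y `<=` hadd (f x) (f y)
}.

Definition isomorphic (F L : hyperfield) :=
  exists (f : F -> L) (g : L -> F),
    [/\ hyperfield_hom f, hyperfield_hom g, cancel f g & cancel g f].

Section FieldHyperfield.
Variable F : fieldType.
Local Open Scope ring_scope.

Definition field_hadd (x y : F) : set F := [set x + y].

Lemma field_hypergroup : hypergroup field_hadd 0.
Proof.
rewrite /field_hadd; split.
- by move=> a b; exists (a + b).
- by move=> a b; rewrite addrC.
- by move=> a b c; rewrite /setadd !bigcup_set1 addrA.
- by move=> x; rewrite add0r.
- move=> x; exists (- x); split=> [|y] /=; first by rewrite subrr.
  by move=> xy0; rewrite -[y](addKr x) -xy0 addr0.
- move=> x y z ny /= yny0; split=> ->.
    by rewrite addrAC -yny0 add0r.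
  by rewrite addrCA -yny0 addr0.
Qed.

Lemma field_hmulDr (a x y : F) :
  *%R a @` field_hadd x y = field_hadd (a * x) (a * y).
Proof. by rewrite /field_hadd image_set1 mulrDr. Qed.

Lemma field_hmulDl (a x y : F) :
  *%R^~ a @` field_hadd x y = field_hadd (x * a) (y * a).
Proof. by rewrite /field_hadd image_set1 mulrDl. Qed.

Definition field_hyperring : hyperring :=
  Hyperring (@mulrA F) (@mulrC F) (@mul1r F) field_hypergroup
    (@mul0r F) (@mulr0 F) field_hmulDr field_hmulDl.

Lemma field_zero_neq_one : 0 <> 1 :> F.
Proof. by apply/eqP; rewrite eq_sym oner_neq0. Qed.

Lemma field_hmulV (x : F) : x <> 0 -> exists y, x * y = 1.
Proof. by move=> /eqP x0; exists x^-1; rewrite divff. Qed.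

Definition field_hyperfield : hyperfield :=
  @Hyperfield field_hyperring field_zero_neq_one field_hmulV.

End FieldHyperfield.

Section Krasner.

Definition krasner_hadd (x y : bool) : set bool :=
  match x, y with
  | false, false => [set false]
  | false, true | true, false => [set true]
  | true, true => [set false; true]
  end.

Lemma krasner_hypergroup : hypergroup krasner_hadd false.
Proof.
split.
- by case; case; [exists true; right | exists true | exists true | exists false].
- by case; case.
- move=> a b c; rewrite /setadd bigcup_set1.
  under [RHS]eq_bigcupr do rewrite bigcup_set1.
  by case: a b c => [] [] [] /=; rewrite ?bigcup_setU ?bigcup_set1.
- by case.
- case; first by exists true; split; [left | case=> //= /esym].
  by exists false; split=> // -[].
- case=> [] [] [] [] //=; split; by [left | right | case | ].
Qed.

Lemma krasner_hmulDr (a x y : bool) :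
  andb a @` krasner_hadd x y = krasner_hadd (a && x) (a && y).
Proof.
by case: a x y => [] [] [] /=; rewrite ?image_setU ?image_set1 //= setUid.
Qed.

Lemma krasner_hmulDl (a x y : bool) :
  andb^~ a @` krasner_hadd x y = krasner_hadd (x && a) (y && a).
Proof.
by case: a x y => [] [] [] /=; rewrite ?image_setU ?image_set1 //= setUid.
Qed.

Definition krasner_hyperring : hyperring :=
  Hyperring andbA andbC andTb krasner_hypergroup andFb andbF
    krasner_hmulDr krasner_hmulDl.

Lemma krasner_zero_neq_one : false <> true.
Proof. by []. Qed.

Lemma krasner_hmulV (x : bool) : x <> false -> exists y, x && y = true.
Proof. by case: x => // _; exists true. Qed.

Definition krasner_hyperfield : hyperfield :=
  @Hyperfield krasner_hyperring krasner_zero_neq_one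
    krasner_hmulV.

End Krasner.

(* Main.v *)
(* Order 2 forces F = {0, 1}, with 1 its own opposite since 0 is not in
   1 + 0 = {1}. Hence 0 lies in 1 + 1, and the only remaining freedom is whether
   1 lies in 1 + 1 (Krasner) or not (F_2). *)
Require Import Defs.
From mathcomp Require Import all_boot all_algebra.
From mathcomp Require Import boolp classical_sets functions cardinality.

Set Implicit Arguments.
Unset Strict Implicit.
Unset Printing Implicit Defensive.

Local Open Scope classical_set_scope.

(** The axioms fix every product and every sum in a hyperfield of order 2 except [hadd hone hone],
    which contains [hzero] ([order2_zero_in_one_plus_one]). So the truth value of [hone] lying in
    [hadd hone hone] is a complete invariant ([order2_isomorphic]). It is false for ['F_2] and true
    for the Krasner hyperfield, so these two are distinct and exhaust all cases. *)

Lemma order2_zero_or_one (F : hyperfield) :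
  has_order F 2 -> forall x : F, x = hzero \/ x = hone.
Proof.
case/card_set_bijP=> f [fI finj _] x.
have f_inj a b : f a = f b -> a = b by apply: finj; rewrite in_setE.
have f01 : f hzero <> f hone by move/f_inj; apply: hzero_neq_one.
have fE y : f y = 0 \/ f y = 1.
  by have /= := fI y I; case: (f y) => [|[|//]] _; [left | right].
suff [/f_inj|/f_inj]: f x = f hzero \/ f x = f hone by [left | right].
(* Since [f hzero] and [f hone] differ, they take both values 0 and 1, so [f x] equals one of
   them. *)
case: (fE x) (fE hzero) (fE hone) f01 => -> [] -> [] -> //; by [left | right].
Qed.

Lemma has_order_F2 : has_order (field_hyperfield 'F_2) 2.
(* The carrier of ['F_2] is convertible to ['I_2]. *)
Proof. exact: (card_esym (@card_II 2)). Qed.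

Lemma has_order_krasner : has_order krasner_hyperfield 2.
Proof.
apply/card_set_bijP; exists nat_of_bool; split.
- by case.
- by move=> [] [].
- by case=> [|[|//]] _; [exists false | exists true].
Qed.

Lemma hadd0x (F : hyperfield) (x : F) : hadd hzero x = [set x].
Proof. exact: hgroup_add0 (hadd_hypergroup F) x. Qed.

Lemma haddx0 (F : hyperfield) (x : F) : hadd x hzero = [set x].
Proof. by rewrite (hgroup_comm (hadd_hypergroup F)) hadd0x. Qed.

Lemma order2_zero_in_one_plus_one (F : hyperfield) :
  has_order F 2 -> hadd hone hone (hzero : F).
Proof.
move=> /order2_zero_or_one F01.
have [y [+ _]] := hgroup_opp (hadd_hypergroup F) hone.
by case: (F01 y) => -> //; rewrite haddx0 => /(@hzero_neq_one F).
Qed.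

(** For [F] of order 2 this is the only candidate for a homomorphism. Equality with [hzero] is
    decided classically, as the carrier is an arbitrary type. *)
Definition two_element_map (F L : hyperfield) (x : F) : L :=
  if pselect (x = hzero) then hzero else hone.

Lemma two_element_map0 (F L : hyperfield) : @two_element_map F L hzero = hzero.
Proof. by rewrite /two_element_map; case: pselect. Qed.

Lemma two_element_map1 (F L : hyperfield) : @two_element_map F L hone = hone.
Proof.
by rewrite /two_element_map; case: pselect => // e; case: (@hzero_neq_one F).
Qed.

(** Homomorphisms only require an inclusion of sums, so a one-way implication suffices. The sole
    nontrivial sum is 1 + 1: its possible element 0 has image in 1 + 1 because [L] has order 2, and
    1 is covered by the implication. *)
Lemma two_element_map_hom (F L : hyperfield) :
  has_order F 2 -> has_order L 2 ->
  (hadd hone hone (hone : F) -> hadd hone hone (hone : L)) ->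
  hyperfield_hom (@two_element_map F L).
Proof.
move=> /order2_zero_or_one F01 L2 FL.
split=> [||x y|x y]; rewrite ?two_element_map0 ?two_element_map1 //.
  by case: (F01 x) => ->; rewrite ?hmul0l ?hmul1 ?two_element_map0
    ?two_element_map1 ?hmul0l ?hmul1.
case: (F01 x) => ->; first by rewrite two_element_map0 !hadd0x image_set1.
case: (F01 y) => ->; first by rewrite two_element_map0 !haddx0 image_set1.
rewrite two_element_map1 => _ [z + <-].
case: (F01 z) => ->; rewrite (two_element_map0, two_element_map1) //.
by move=> _; apply: order2_zero_in_one_plus_one.
Qed.

Lemma two_element_mapK (F L : hyperfield) :
  has_order F 2 -> cancel (@two_element_map F L) (@two_element_map L F).
Proof.
move=> /order2_zero_or_one F01 x.
by case: (F01 x) => ->; rewrite ?two_element_map0 ?two_element_map1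
  ?two_element_map0 ?two_element_map1.
Qed.

Lemma order2_isomorphic (F L : hyperfield) :
  has_order F 2 -> has_order L 2 ->
  (hadd hone hone (hone : F) <-> hadd hone hone (hone : L)) ->
  isomorphic F L.
Proof.
move=> F2 L2 [FL LF]; exists (@two_element_map F L), (@two_element_map L F).
by split; [exact: two_element_map_hom | exact: two_element_map_hom
  | exact: two_element_mapK | exact: two_element_mapK].
Qed.

Lemma F2_one_notin_one_plus_one :
  ~ hadd hone hone (hone : field_hyperfield 'F_2).
(* Membership in the singleton sum is the equation 1 = 1 + 1, whose sides have representatives 1 and
   0. *)
Proof. by move/(congr1 val). Qed.

Lemma krasner_one_in_one_plus_one : hadd hone hone (hone : krasner_hyperfield).
Proof. by right. Qed.

Theorem proposition2p1 :
  [/\ has_order (field_hyperfield 'F_2) 2,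
      has_order krasner_hyperfield 2,
      ~ isomorphic (field_hyperfield 'F_2) krasner_hyperfield &
      forall F : hyperfield, has_order F 2 ->
        isomorphic F (field_hyperfield 'F_2) \/ isomorphic F krasner_hyperfield].
Proof.
split; [exact: has_order_F2 | exact: has_order_krasner | |].
  (* The obstruction lies in the inverse [g], from the Krasner hyperfield to ['F_2]: it would carry
     1 in 1 + 1 to the same membership in ['F_2]. *)
  move=> [_ [g [_ [_ g1 _ gD] _ _]]]; apply: F2_one_notin_one_plus_one.
  have := gD hone hone _ (ex_intro2 _ _ _ krasner_one_in_one_plus_one erefl).
  by rewrite g1.
move=> F F2; have [F11|F11] := pselect (hadd hone hone (hone : F)).
  right; apply: order2_isomorphic F2 has_order_krasner _.
  by split=> // _; exact: krasner_one_in_one_plus_one.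
left; apply: order2_isomorphic F2 has_order_F2 _.
by split=> // /F2_one_notin_one_plus_one.
Qed.
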